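(* The free critical points of the rational function $$O(z)=z^n\,\frac{a_k+a_{k-1}z+\dots+a_1z^{k-1}+z^k}{1+a_1z+\dots+a_{k-1}z^{k-1}+a_kz^k},\qquad a_k\neq 0,$$ with real coefficients satisfy that they are either pairs of inverse real roots, or complex conjugates and lie on the unit circle, or they are a set of four related roots of a quartic palindromic polynomial.
   Context: The map $O$ is a rational map of the Riemann sphere $\widehat{\mathbb{C}}$; it is the generic expression of the operators obtained by applying Newton-like root-finding methods to polynomials of degree two, after a conjugacy sending the two roots to $0$ and $\infty$. Here $n$ and $k$ are the integer exponents displayed in the formula, and ''with real coefficients'' means that $a_1,\dots,a_k$ are real. A critical point of $O$ is a point $c\in\widehat{\mathbb{C}}$ with $O'(c)=0$; it is called free if it is not a fixed point of $O$. The word ''roots'' refers to the critical points different from $0$ and $\infty$ as roots of the polynomial $P$ in the numerator of the derivative, where $O'(z)=z^{n-1}P(z)/\left(1+a_1z+\dots+a_kz^k\right)^2$; this polynomial $P$ is palindromic. A polynomial $A_0+A_1z+\dots+A_mz^m$ of degree $m$ is palindromic if $A_i=A_{m-i}$ for $0\le i\le m$. The unit circle is $\{z\in\mathbb{C}:|z|=1\}$. *)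

(* Defs.v *)
From HB Require Import structures.
From mathcomp Require Import all_boot all_order all_algebra.
From mathcomp Require Import all_classical all_reals all_analysis.
From mathcomp Require Import complex ring.
Set Implicit Arguments.
Unset Strict Implicit.
Unset Printing Implicit Defensive.
Import Order.TTheory GRing.Theory Num.Theory.
Import numFieldNormedType.Exports.
Local Open Scope ring_scope.

(* [R[i]] seen as a [numClosedFieldType], which makes the normed module
   structure of the library available on it. *)
Definition Cplx (R : realType) : numClosedFieldType := R[i]%C.

Definition toC (R : realType) (x : R) : Cplx R := x%:C%C.
Definition polytoC (R : realType) (p : {poly R}) : {poly Cplx R} :=
  map_poly (@toC R) p.

(* The Riemann sphere: [Some z] is the finite point z, [None] is oo. *)
Definition sphere (R : realType) : Type := one_point_compactification (Cplx R).

Section RiemannSphere.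
Variable R : realType.
Local Notation C := (Cplx R).
Local Notation S := (sphere R).

Definition sphere_inv (z : S) : S :=
  if z is Some w then (if w == 0 then None else Some w^-1) else Some 0.

(* The map z |-> p(z) / q(z) of the sphere. The fraction is first reduced, so
   that common roots of p and q are removable. The value at oo is the ratio of
   the coefficients of degree max (deg p) (deg q) of the reduced fraction. *)
Definition rational_map (p q : {poly C}) (z : S) : S :=
  let p1 := p %/ gcdp p q in
  let q1 := q %/ gcdp p q in
  let d := (maxn (size p1) (size q1)).-1 in
  let: (u, v) := if z is Some w then (p1.[w], q1.[w]) else (p1`_d, q1`_d) in
  if v == 0 then None else Some (u / v).

(* The chart used around c: z itself if c is finite, 1/z if c = oo. *)
Definition chart_at (c z : S) : S := if c is Some _ then z else sphere_inv z.

Definition affine_coord (z : S) : C := odflt 0 z.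

(* The expression of F in the charts at c and at F c. [chart_at] is an
   involution, so it also serves as the inverse chart at the source. *)
Definition local_expr (F : S -> S) (c : S) (w : C) : C :=
  affine_coord (chart_at (F c) (F (chart_at c (Some w)))).

(* F'(c) = 0, read in the charts when c or F c is oo. *)
Definition critical_point (F : S -> S) (c : S) : Prop :=
  is_derive (affine_coord (chart_at c c)) (1 : C) (local_expr F c) 0.

Definition free_critical_point (F : S -> S) (c : S) : Prop :=
  critical_point F c /\ F c <> c.

End RiemannSphere.

Section Operator.
Variable R : realType.
Implicit Types (n : int) (k : nat) (a : nat -> R).

(* a_k + a_(k-1) X + ... + a_1 X^(k-1) + X^k *)
Definition numer k a : {poly R} :=
  \sum_(1 <= i < k.+1) a i *: 'X^(k - i) + 'X^k.

(* 1 + a_1 X + ... + a_k X^k *)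
Definition denom k a : {poly R} := 1 + \sum_(1 <= i < k.+1) a i *: 'X^i.

(* X^n * numer / denom as a quotient of polynomials: for negative n the power
   of X goes to the denominator. *)
Definition op_num n k a : {poly R} :=
  if n is Posz m then 'X^m * numer k a else numer k a.
Definition op_den n k a : {poly R} :=
  if n is Negz m then 'X^(m.+1) * denom k a else denom k a.

Definition opO n k a : sphere R -> sphere R :=
  rational_map (polytoC (op_num n k a)) (polytoC (op_den n k a)).

(* The polynomial P such that O' = X^(n-1) * P / denom^2; see [critP_deriv]. *)
Definition critP n k a : {poly R} :=
  n%:~R *: (numer k a * denom k a) +
  'X * ((numer k a)^`() * denom k a - numer k a * (denom k a)^`()).

Lemma critP_deriv n k a :
  'X * ((op_num n k a)^`() * op_den n k a - op_num n k a * (op_den n k a)^`())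
  = 'X^(`|n|) * critP n k a.
Proof.
rewrite /critP; case: n => m /=.
  rewrite derivM derivXn -pmulrn -mulr_natl -[m%:R *: _]mul_polyC polyCMn.
  case: m => [|m]; rewrite ?mulr0n ?mul0r ?expr0; last rewrite /= exprS; ring.
rewrite NegzE derivM derivXn /= -mulr_natl mulrNz -pmulrn -mul_polyC.
by rewrite polyCN polyCMn exprS; ring.
Qed.

End Operator.

(* Polynomials of degree exactly m with A_i = A_(m - i). *)
Definition palindromic (R : realType) (m : nat) (A : {poly R}) : Prop :=
  size A = m.+1 /\ forall i : nat, (i <= m)%N -> A`_i = A`_(m - i).

(* Main.v *)
Require Import Defs.
From HB Require Import structures.
From mathcomp Require Import all_boot all_order all_algebra.
From mathcomp Require Import all_classical all_reals all_analysis.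
From mathcomp Require Import complex ring zify.
Set Implicit Arguments.
Unset Strict Implicit.
Unset Printing Implicit Defensive.
Import Order.TTheory GRing.Theory Num.Theory.
Import numFieldNormedType.Exports.
Local Open Scope ring_scope.

(** The numerator p and the denominator q of O are mirror images of each other:
    q(z) = z^M p(1/z) with M = |n| + k. Hence O(1/z) = 1/O(z), and as the
    coefficients are real, O(conj z) = conj O(z). Both symmetries send fixed
    points to fixed points and critical points to critical points, so the free
    critical points other than 0 and oo form a set stable under inversion and
    conjugation. A real z comes with 1/z; a non-real z with |z| = 1 comes with
    conj z = 1/z; any other z has an orbit of exactly four points, and the
    monic quartic vanishing on that orbit is real and palindromic.

    What needs care is that the fraction p/q may be reducible, while O and its
    derivative live on the reduced fraction u/v. The mirror symmetry survives
    reduction up to a common factor h: the mirror images of u and v are h v and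
    h u ([recip_reduced]), with h(z) nonzero wherever z is, because u and v
    have no common root. The critical points z <> 0 are the zeros of
    u' v - u v' ([critical_pointE]): where v(z) = 0 the derivative is that of
    v/u, which has the same numerator up to sign. This Wronskian, multiplied
    by z, is preserved by the mirror symmetry up to the factor h^2
    ([recip_eulerW_reduced]), which gives [free_critical_point_inv].

    The Wronskian of p and q is the one of u and v times the square of the gcd,
    so every critical point z <> 0 is a root of P ([root_critP]). Distinct roots
    give the claimed factors of P; the pair r, 1/r degenerates when r = 1 or
    r = -1. Such an r can be a free critical point, since O(1/r) = 1/O(r) only
    says that O(r) is 1 or -1. There the double factor comes from the symmetry
    z^(2k) P(1/z) = P(z), which makes P' vanish with P
    ([recip_fixed_double_root]). *)

(** * Reciprocal polynomials *)

Section Reciprocal.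
Variable R : comNzRingType.
Implicit Types (p q : {poly R}) (m l : nat).

(** This is X^m p(1/X). The degree m is a parameter and not the degree of p:
    zeros at 0 count as a drop of degree of the mirror image, and only with a
    prescribed m is the operation linear and an involution. *)
Definition recip m p : {poly R} := \poly_(i < m.+1) p`_(m - i).

Lemma coef_recip m p i : (recip m p)`_i = if (i <= m)%N then p`_(m - i) else 0.
Proof. by rewrite coef_poly ltnS. Qed.

Lemma size_recip m p : (size (recip m p) <= m.+1)%N.
Proof. exact: size_poly. Qed.

Lemma recip_is_linear m : linear (recip m).
Proof.
move=> c p q; apply/polyP => i.
by rewrite !(coefD, coefZ, coef_recip); case: ifP; rewrite ?mulr0 ?addr0.
Qed.
HB.instance Definition _ m :=
  GRing.isLinear.Build R {poly R} {poly R} *:%R (recip m) (@recip_is_linear m).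

Lemma recipK m p : (size p <= m.+1)%N -> recip m (recip m p) = p.
Proof.
move=> sp; apply/polyP => i; rewrite coef_recip.
case: leqP => im; first by rewrite coef_recip leq_subr subKn.
by rewrite nth_default // (leq_trans sp).
Qed.

Lemma recip_mulXn m l i p : (i <= m)%N -> (size p <= l.+1)%N ->
  recip (m + l) ('X^i * p) = 'X^(m - i) * recip l p.
Proof.
move=> im sp; apply/polyP => j; rewrite !(coefXnM, coef_recip).
case: (ltnP j (m - i)) => jm.
  rewrite nth_default; first by rewrite !if_same.
  by rewrite (leq_trans sp) //; lia.
case: (leqP j (m + l)) => jml /=; last by rewrite ifF //; lia.
case: (ltnP (m + l - j) i) => ij /=; first by rewrite ifF //; lia.
by rewrite ifT; [congr (p`_ _)|]; lia.
Qed.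

Lemma recip_Xn m i : (i <= m)%N -> recip m 'X^i = 'X^(m - i).
Proof.
move=> im; rewrite -['X^i]mulr1 -{1}(addn0 m) recip_mulXn ?size_poly1 //.
rewrite (_ : recip 0 1 = 1) ?mulr1 //.
by apply/polyP => j; rewrite coef_recip !coef1 sub0n leqn0; case: eqP.
Qed.

Lemma recipM m l p q : (size p <= m.+1)%N -> (size q <= l.+1)%N ->
  recip (m + l) (p * q) = recip m p * recip l q.
Proof.
move=> sp sq.
have -> : p = \sum_(i < m.+1) p`_i *: 'X^i.
  rewrite -poly_def; apply/polyP => i; rewrite coef_poly.
  by case: ltnP => // /(leq_trans sp) ?; rewrite nth_default.
rewrite mulr_suml !linear_sum mulr_suml; apply: eq_bigr => i _.
by rewrite -scalerAl !linearZ /= recip_mulXn ?recip_Xn ?scalerAl -1?ltnS.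
Qed.

(** Mirroring turns the exponent i of a monomial into m - i, and the Euler
    operator X d/dX multiplies by the exponent. *)
Lemma recip_euler m p : (size p <= m.+1)%N ->
  'X * (recip m p)^`() = m%:R *: recip m p - recip m ('X * p^`()).
Proof.
move=> sp; apply/polyP => i.
rewrite !(coefB, coefZ, coefXM, coef_recip, coef_deriv).
case: i => [|i] /=.
  rewrite subn0; case: m sp => [|m] sp /=; first by rewrite mul0r subr0.
  by rewrite mulr_natl subrr.
case: ltnP => im; last by rewrite mul0rn mulr0 subr0.
have [-> | mi] := eqVneq m i.+1; first by rewrite subnn /= subr0 mulr_natl.
rewrite (_ : (m - i.+1 == 0)%N = false); last by lia.
rewrite prednK; last by lia.
by rewrite mulr_natl -mulrnBr ?leq_subr //; congr (_ *+ _); lia.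
Qed.

Lemma size_euler m p : (size p <= m.+1)%N -> (size ('X * p^`())%R <= m.+1)%N.
Proof.
move=> sp; rewrite mulrC; have [->|d0] := eqVneq p^`() 0.
  by rewrite mul0r size_poly0.
rewrite size_mulX // (leq_trans _ sp) // lt_size_deriv //.
by apply: contraNneq d0 => ->; rewrite deriv0.
Qed.

(** The Wronskian for the Euler operator X d/dX. The factor X makes it
    compatible with mirroring. *)
Definition eulerW p q : {poly R} := 'X * (p^`() * q - p * q^`()).

Lemma eulerWE p q : eulerW p q = ('X * p^`()) * q - p * ('X * q^`()).
Proof. by rewrite /eulerW; ring. Qed.

Lemma size_eulerW m p q : (size p <= m.+1)%N -> (size q <= m.+1)%N ->
  (size (eulerW p q) <= (m + m).+1)%N.
Proof.
move=> sp sq; rewrite eulerWE (leq_trans (size_polyD _ _)) //.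
rewrite size_polyN geq_max.
have sM (f g : {poly R}) : (size f <= m.+1)%N -> (size g <= m.+1)%N ->
    (size (f * g)%R <= (m + m).+1)%N.
  move=> sf sg; rewrite (leq_trans (size_polyMleq _ _)) // -subn1 leq_subLR.
  by rewrite add1n -addnS -addSn leq_add.
by rewrite !sM ?size_euler.
Qed.

Lemma eulerWC p q : eulerW q p = - eulerW p q.
Proof. by rewrite /eulerW; ring. Qed.

Lemma eulerW_mull g p q : eulerW (g * p) (g * q) = g ^+ 2 * eulerW p q.
Proof. by rewrite /eulerW !derivM; ring. Qed.

(** By [recip_euler], the Euler operator becomes m minus itself after
    mirroring; the two contributions of m cancel in the Wronskian. *)
Lemma recip_eulerW m p q : (size p <= m.+1)%N -> (size q <= m.+1)%N ->
  recip (m + m) (eulerW p q) = - eulerW (recip m p) (recip m q).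
Proof.
move=> sp sq.
rewrite !eulerWE linearB /= !recipM ?size_euler // !recip_euler //.
by rewrite -!mul_polyC; ring.
Qed.

End Reciprocal.

Lemma map_recip (R S : comNzRingType) (f : {rmorphism R -> S}) m
    (p : {poly R}) :
  map_poly f (recip m p) = recip m (map_poly f p).
Proof.
apply/polyP => i; rewrite coef_map /= !coef_recip.
by case: ifP => _; rewrite ?rmorph0 ?coef_map.
Qed.

Lemma map_eulerW (R S : comNzRingType) (f : {rmorphism R -> S})
    (p q : {poly R}) :
  map_poly f (eulerW p q) = eulerW (map_poly f p) (map_poly f q).
Proof.
by rewrite /eulerW !deriv_map -!rmorphM -rmorphB -(map_polyX f) -rmorphM.
Qed.

Section ReciprocalField.
Variable F : fieldType.
Implicit Types (p q u v : {poly F}) (m l : nat).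

Lemma horner_recip m p x : (size p <= m.+1)%N -> x != 0 ->
  (recip m p).[x] = x ^+ m * p.[x^-1].
Proof.
move=> sp x0; rewrite horner_poly (horner_coef_wide _ sp) mulr_sumr.
rewrite (reindex_inj rev_ord_inj) /=; apply: eq_bigr => i _.
have im : (i <= m)%N by rewrite -ltnS.
rewrite subSS subKn // mulrCA; congr (_ * _).
move: (val i) im => j jm; rewrite -[in RHS](subnK jm) exprD -mulrA -exprMn.
by rewrite mulfV // expr1n mulr1.
Qed.

(** Mirroring p = u g and q = v g shows that u / v and recip v / recip u are
    the same fraction. The former being reduced, the latter is obtained from it
    by a common factor h. *)
Lemma recip_reduced M p q (g := gcdp p q) (u := p %/ g) (v := q %/ g) :
    (size p <= M.+1)%N -> recip M p = q -> p != 0 ->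
  exists m h, [/\ (size u <= m.+1)%N, (size v <= m.+1)%N,
    recip m u = h * v & recip m v = h * u].
Proof.
move=> sp pq p0.
have sq : (size q <= M.+1)%N by rewrite -pq size_recip.
have qp : recip M q = p by rewrite -pq recipK.
have q0 : q != 0 by apply: contraNneq p0 => q0; rewrite -qp q0 linear0.
have g0 : g != 0 by rewrite gcdp_eq0 (negbTE p0).
have pE : p = u * g by rewrite divpK // dvdp_gcdl.
have qE : q = v * g by rewrite divpK // dvdp_gcdr.
have u0 : u != 0 by apply: contraNneq p0; rewrite {1}pE => ->; rewrite mul0r.
have v0 : v != 0 by apply: contraNneq q0; rewrite {1}qE => ->; rewrite mul0r.
(* [e] is the degree of g, so that [m] bounds the degrees of u and v. *)
pose e := (size g).-1; pose m := (M - e)%N.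
have gpos : (0 < size g)%N by rewrite size_poly_gt0.
have sg : (size g <= e.+1)%N by rewrite /e prednK.
have upos : (0 < size u)%N by rewrite size_poly_gt0.
have vpos : (0 < size v)%N by rewrite size_poly_gt0.
have := size_mul u0 g0; rewrite -pE => sizep.
have := size_mul v0 g0; rewrite -qE => sizeq.
have size_quo (b c d : nat) : (0 < c)%N -> d = (b + c).-1 -> (d <= M.+1)%N ->
  (b <= (M - c.-1).+1)%N by lia.
have su : (size u <= m.+1)%N := size_quo _ _ _ gpos sizep sp.
have sv : (size v <= m.+1)%N := size_quo _ _ _ gpos sizeq sq.
have deg_g (b c d : nat) : (0 < b)%N -> d = (b + c).-1 -> (d <= M.+1)%N ->
  (c.-1 <= M)%N by lia.
have Me : M = (m + e)%N by rewrite subnK // (deg_g _ _ _ upos sizep sp).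
have gt0 : recip e g != 0.
  by apply: contraNneq g0 => gt0; rewrite -(recipK sg) gt0 linear0.
have Ug : recip m u * recip e g = v * g by rewrite -recipM // -Me -pE pq.
have Vg : recip m v * recip e g = u * g by rewrite -recipM // -Me -qE qp.
have uUvV : u * recip m u = v * recip m v.
  by apply: (mulIf gt0); rewrite -!mulrA Ug Vg; ring.
have cuv : coprimep v u by rewrite coprimep_sym coprimep_div_gcd // p0.
have /dvdpP [h hE] : v %| recip m u.
  by rewrite -(Gauss_dvdpr _ cuv) uUvV dvdp_mulr.
exists m, h; split => //; apply: (mulfI v0); rewrite -uUvV hE; ring.
Qed.

Lemma recip_eulerW_reduced m h u v :
    (size u <= m.+1)%N -> (size v <= m.+1)%N ->
    recip m u = h * v -> recip m v = h * u ->
  recip (m + m) (eulerW u v) = h ^+ 2 * eulerW u v.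
Proof.
move=> su sv hu hv.
by rewrite recip_eulerW // hu hv eulerW_mull eulerWC mulrN opprK.
Qed.

End ReciprocalField.

(** Evaluated at e = 1/e, the identity of [recip_euler] for a self-reciprocal p
    reads e p'(e) = 2m p(e) - e p'(e), because e^(2m) = 1. The evenness of the
    degree is essential at e = -1: X + 1 is self-reciprocal of degree one. *)
Lemma recip_fixed_double_root (F : numFieldType) m (p : {poly F}) e :
  recip (m + m) p = p -> e ^+ 2 = 1 -> root p e -> ('X - e%:P) ^+ 2 %| p.
Proof.
move=> rp e2 pe.
have e0 : e != 0.
  by apply: contra_eq_neq e2 => ->; rewrite expr0n eq_sym oner_neq0.
have sp : (size p <= (m + m).+1)%N by rewrite -rp size_recip.
have pe' : p^`().[e] = 0.
  have := congr1 (horner^~ e) (recip_euler sp).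
  rewrite rp /= hornerM hornerX hornerD hornerN hornerZ.
  rewrite horner_recip ?size_euler //.
  rewrite (rootP pe) mulr0 sub0r hornerM hornerX.
  have -> : e^-1 = e by apply: (mulfI e0); rewrite mulfV // -expr2.
  rewrite addnn -mul2n exprM e2 expr1n mul1r => /eqP.
  rewrite -addr_eq0 -mulr2n -mulr_natl !mulf_eq0 (negbTE e0) pnatr_eq0 /=.
  by move/eqP.
move: pe; rewrite root_factor_theorem => /dvdpP [r pE].
move: pe'; rewrite pE derivM derivXsubC !hornerE subrr mulr0 add0r => /rootP.
by rewrite root_factor_theorem => re; rewrite expr2 dvdp_mul.
Qed.

(** * The polynomials of the operator *)

Section OperatorPolynomials.
Variable R : realType.
Implicit Types (n : int) (k : nat) (a : nat -> R).

Lemma size_denom k a : (size (denom k a) <= k.+1)%N.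
Proof.
rewrite (leq_trans (size_polyD _ _)) // geq_max size_poly1 /=.
rewrite (leq_trans (size_sum _ _ _)) //; apply/bigmax_leqP_seq => i.
rewrite mem_index_iota => /andP [_ ik] _.
by rewrite (leq_trans (size_scale_leq _ _)) // size_polyXn.
Qed.

Lemma recip_denom k a : recip k (denom k a) = numer k a.
Proof.
rewrite /denom /numer linearD /= addrC -(expr0 'X) recip_Xn // subn0.
congr (_ + _); rewrite linear_sum; apply: eq_big_nat => i /andP [_ ik].
by rewrite linearZ /= recip_Xn.
Qed.

Lemma size_numer k a : (size (numer k a) <= k.+1)%N.
Proof. by rewrite -recip_denom size_recip. Qed.

Lemma recip_numer k a : recip k (numer k a) = denom k a.
Proof. by rewrite -recip_denom recipK ?size_denom. Qed.

Lemma denom0 k a : (denom k a).[0] = 1.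
Proof.
rewrite hornerD horner_sum big1_seq ?addr0 ?hornerE // => i.
rewrite mem_index_iota /= => /andP [i0 _].
by rewrite hornerZ hornerXn expr0n eqn0Ngt i0 mulr0.
Qed.

Lemma numer_neq0 k a : numer k a != 0.
Proof.
apply/eqP => N0; have /eqP := denom0 k a.
by rewrite -recip_numer N0 linear0 horner0 eq_sym oner_eq0.
Qed.

Lemma sizeE_numer k a : size (numer k a) = k.+1.
Proof.
apply/eqP; rewrite eqn_leq size_numer ltnNge; apply/negP => sN.
have : (numer k a)`_k = 0 by rewrite nth_default.
move/eqP; rewrite -recip_denom coef_recip leqnn subnn -horner_coef0 denom0.
by rewrite oner_eq0.
Qed.

Lemma op_num_neq0 n k a : op_num n k a != 0.
Proof.
case: n => m /=; last exact: numer_neq0.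
by rewrite mulf_neq0 ?numer_neq0 // expf_neq0 // polyX_eq0.
Qed.

(** For n >= 0 the factor X^n of the numerator is mirrored to 1, while for
    n < 0 mirroring in the larger degree creates the factor X^|n| of the
    denominator. *)
Lemma op_recip n k a :
  (size (op_num n k a) <= (`|n| + k).+1)%N /\
  recip (`|n| + k) (op_num n k a) = op_den n k a.
Proof.
case: n => m /=; last first.
  split; first by rewrite sizeE_numer ltnS leq_addl.
  rewrite -[numer k a]mul1r recipM ?size_poly1 ?size_numer // recip_numer.
  by rewrite -(expr0 'X) recip_Xn // subn0.
split.
  by rewrite mulrC size_mulXn ?numer_neq0 // sizeE_numer addnS.
rewrite recipM ?size_polyXn ?size_numer // recip_numer recip_Xn //.
by rewrite subnn mul1r.
Qed.

(** P is n N D plus the Euler Wronskian of N and D. Mirroring exchanges N and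
    D, and the sign that it brings to the Wronskian undoes the exchange. *)
Lemma recip_critP n k a : recip (k + k) (critP n k a) = critP n k a.
Proof.
have -> : critP n k a =
    n%:~R *: (numer k a * denom k a) + eulerW (numer k a) (denom k a) by [].
rewrite linearD linearZ /= recip_eulerW ?size_numer ?size_denom //.
rewrite recipM ?size_numer ?size_denom // recip_numer recip_denom.
by rewrite -eulerWC mulrC.
Qed.

End OperatorPolynomials.

(** * Critical points of rational maps of the sphere *)

Section PolynomialDerivative.
Variable K : numFieldType.
Implicit Types (p u v : {poly K}) (x : K).

Lemma is_derive_horner p x : is_derive x (1 : K) (fun w : K => p.[w]) p^`().[x].
Proof.
elim/poly_ind: p => [|p c ih].
  rewrite deriv0 horner0 (_ : (fun w : K => _) = cst 0).
    exact: is_derive_cst.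
  by apply/funext => w; rewrite horner0.
have -> : (fun w : K => (p * 'X + c%:P).[w]) =
    (fun w : K => p.[w]) * (@id K) + (cst c : K -> K).
  by apply/funext => w; rewrite !hornerE.
apply: is_derive_eq.
rewrite derivD derivC addr0 derivM derivX !hornerE /= addrC.
by rewrite [_ *: 1]mulr1 [_ *: _]mulrC.
Qed.

Lemma is_derive_quotient u v x : v.[x] != 0 ->
  is_derive x (1 : K) (fun w : K => u.[w] / v.[w])
    ((u^`() * v - u * v^`()).[x] / v.[x] ^+ 2).
Proof.
move=> vx; have du := is_derive_horner u x; have dv := is_derive_horner v x.
have dV : is_derive x (1 : K) (fun w : K => v.[w]^-1)
    (- v.[x] ^- 2 *: v^`().[x]).
  split; first by apply: derivableV => //; exact: ex_derive.
  by rewrite deriveV ?derive_val //; exact: ex_derive.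
have dM := is_deriveM du dV.
rewrite (_ : (fun w : K => _) = (fun w => u.[w]) * (fun w => v.[w]^-1)) //.
apply: is_derive_eq.
rewrite !hornerE /GRing.scale /=; field; exact: vx.
Qed.

End PolynomialDerivative.

Section SphereMaps.
Variable R : realType.
Local Notation C := (Cplx R).
Implicit Types (p q u v : {poly C}) (z w : C).

(** The point of the sphere with homogeneous coordinates [x : y]. *)
Definition proj_point (x y : C) : sphere R :=
  if y == 0 then None else Some (x / y).

Lemma rational_mapE p q w :
  rational_map p q (Some w) =
  proj_point (p %/ gcdp p q).[w] (q %/ gcdp p q).[w].
Proof. by []. Qed.

(** In the chart at the image, the local expression is u/v if v(z) <> 0 and
    v/u otherwise, everywhere and not only near z: at the points that the chart
    misses, its default value 0 agrees with the convention x / 0 = 0. *)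
Lemma critical_pointE p q (u := p %/ gcdp p q) (v := q %/ gcdp p q) z :
    p != 0 ->
  critical_point (rational_map p q) (Some z) <->
  (u^`() * v - u * v^`()).[z] = 0.
Proof.
move=> p0; have cop : coprimep u v by rewrite coprimep_div_gcd // p0.
rewrite /critical_point /=.
have [vz|vz] := eqVneq v.[z] 0.
  have uz : u.[z] != 0.
    by apply: (@coprimep_root _ v u); [rewrite coprimep_sym | apply/rootP].
  have -> : local_expr (rational_map p q) (Some z) =
      (fun w : C => v.[w] / u.[w]).
    apply/funext => w.
    rewrite /local_expr /= !rational_mapE -/u -/v /proj_point.
    rewrite vz eqxx /=; case: eqVneq => [->|vw] /=; first by rewrite mul0r.
    case: eqVneq => [|uvw] /=.
      move/eqP; rewrite mulf_eq0 invr_eq0 (negbTE vw) orbF => /eqP ->.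
      by rewrite invr0 mulr0.
    by rewrite invf_div.
  have dq := is_derive_quotient v uz.
  have -> : u^`() * v - u * v^`() = - (v^`() * u - v * u^`()) by ring.
  split => [d0|/eqP].
    have := @derive_val _ _ _ _ _ _ _ d0.
    rewrite (@derive_val _ _ _ _ _ _ _ dq) => /eqP.
    rewrite mulf_eq0 invr_eq0 sqrf_eq0 (negbTE uz) orbF => /eqP W0.
    by rewrite hornerN W0 oppr0.
  rewrite hornerN oppr_eq0 => /eqP W0.
  by move: dq; rewrite W0 mul0r.
have -> : local_expr (rational_map p q) (Some z) = (fun w : C => u.[w] / v.[w]).
  apply/funext => w; rewrite /local_expr /= !rational_mapE -/u -/v /proj_point.
  rewrite (negbTE vz) /=; case: eqVneq => [->|vw] //=.
  by rewrite invr0 mulr0.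
have dq := is_derive_quotient u vz.
split => [d0|W0]; last by move: dq; rewrite W0 mul0r.
have := @derive_val _ _ _ _ _ _ _ d0.
rewrite (@derive_val _ _ _ _ _ _ _ dq) => /eqP.
by rewrite mulf_eq0 invr_eq0 sqrf_eq0 (negbTE vz) orbF => /eqP W0.
Qed.

End SphereMaps.

(** * Symmetries of the free critical points *)

Section RealCoefficients.
Variable R : realType.
Local Notation C := (Cplx R).
Implicit Types (p q u v P : {poly R}) (z w : C) (n : int) (k : nat)
  (a : nat -> R).

HB.instance Definition _ :=
  GRing.RMorphism.copy (@toC R : R -> C) (real_complex R).

Lemma toC_real (x : R) : toC x \is Num.real.
Proof. by rewrite /toC complex_real. Qed.

Lemma realC_toC z : z \is Num.real -> exists x : R, z = toC x.
Proof. by move=> zR; exists (complex.Re z); rewrite /toC RRe_real. Qed.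

Lemma conj_horner_polytoC p z : (polytoC p).[z^*] = ((polytoC p).[z])^*.
Proof.
rewrite -horner_map; congr (_.[_]); apply/polyP => i.
by rewrite !coef_map /= conj_Creal ?toC_real.
Qed.

Lemma root_polytoC_conj p z : root (polytoC p) z^* = root (polytoC p) z.
Proof. by rewrite /root conj_horner_polytoC conjC_eq0. Qed.

Lemma root_polytoC_toC p (x : R) : root (polytoC p) (toC x) = root p x.
Proof. exact: fmorph_root. Qed.

(** Since gcd and quotient commute with the extension of scalars, the reduced
    fraction has real coefficients too; this is what makes conjugation act. *)
Lemma free_critical_pointP p q (g := gcdp p q) (u := p %/ g) (v := q %/ g) z :
    p != 0 -> z != 0 ->
  free_critical_point (rational_map (polytoC p) (polytoC q)) (Some z) <->
  root (polytoC (eulerW u v)) z /\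
  proj_point (polytoC u).[z] (polytoC v).[z] <> Some z.
Proof.
move=> p0 z0; rewrite /free_critical_point rational_mapE.
rewrite critical_pointE ?map_poly_eq0 //.
rewrite -!gcdp_map -!map_divp -/g -/u -/v.
suff -> : root (polytoC (eulerW u v)) z <->
   (((polytoC u)^`() * polytoC v - polytoC u * (polytoC v)^`()).[z] = 0) by [].
rewrite /polytoC map_eulerW /eulerW /root hornerM hornerX mulf_eq0.
by rewrite (negbTE z0); split=> /eqP.
Qed.

Lemma free_critical_point_conj p q z : p != 0 -> z != 0 ->
    free_critical_point (rational_map (polytoC p) (polytoC q)) (Some z) ->
  free_critical_point (rational_map (polytoC p) (polytoC q)) (Some z^*).
Proof.
move=> p0 z0 /(free_critical_pointP q p0 z0) [Wz Oz].
apply/free_critical_pointP; rewrite ?conjC_eq0 ?root_polytoC_conj //.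
split=> // Oz'.
apply: Oz; move: Oz'; rewrite !conj_horner_polytoC /proj_point conjC_eq0.
case: ifP => // _ [] /esym zE; congr Some; apply: (can_inj (@conjCK C)).
by rewrite fmorph_div.
Qed.

(** At a point z <> 0 the pair (u, v)(1/z) is a nonzero multiple of (v, u)(z),
    so the image of 1/z is the inverse of the image of z, poles and zeros
    included. *)
Lemma free_critical_point_inv M p q z :
    (size p <= M.+1)%N -> recip M p = q -> p != 0 -> z != 0 ->
    free_critical_point (rational_map (polytoC p) (polytoC q)) (Some z) ->
  free_critical_point (rational_map (polytoC p) (polytoC q)) (Some z^-1).
Proof.
move=> sp pq p0 z0 /(free_critical_pointP q p0 z0) [Wz Oz].
have [m [h [su sv]]] := recip_reduced sp pq p0.
set u := p %/ _ in su sv Wz Oz *; set v := q %/ _ in sv Wz Oz *.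
move=> hu hv.
have cuv : coprimep u v by rewrite coprimep_div_gcd // p0.
have hW := recip_eulerW_reduced su sv hu hv.
have sW := size_eulerW su sv.
have horner_inv (l : nat) (r s : {poly R}) :
    (size r <= l.+1)%N -> recip l r = s ->
    (polytoC r).[z^-1] = (z ^+ l)^-1 * (polytoC s).[z].
  move=> sr <-; rewrite /polytoC map_recip horner_recip ?size_map_poly //.
  by rewrite mulKf // expf_neq0.
have uz := horner_inv _ _ _ su hu; have vz := horner_inv _ _ _ sv hv.
have Wzi := horner_inv _ _ _ sW hW.
rewrite /polytoC rmorphM /= hornerM in uz.
rewrite /polytoC rmorphM /= hornerM in vz.
have cuvC : coprimep (polytoC u) (polytoC v) by rewrite coprimep_map.
(* A zero of h would make 1/z a common root of u and v. *)
have hz : (map_poly (@toC R) h).[z] != 0.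
  apply/negP => /eqP h0; move: uz vz; rewrite h0 !mul0r !mulr0 => uz /eqP vz.
  by have := coprimep_root cuvC (introT rootP uz); rewrite vz.
apply/free_critical_pointP; rewrite ?invr_eq0 // -/u -/v; split.
  by rewrite /root Wzi /polytoC rmorphM hornerM (rootP Wz) !mulr0.
rewrite /polytoC uz vz !mulrA; set c := _^-1 * _.
have c0 : c != 0 by rewrite mulf_neq0 // invr_eq0 expf_neq0.
move=> Ozi; apply: Oz; move: Ozi.
rewrite /proj_point /polytoC mulf_eq0 (negbTE c0) /=.
set x := _.[z]; set y := _.[z]; case: (eqVneq y 0) => // y0 [].
rewrite -mulf_div divff // mul1r => xy.
case: (eqVneq x 0) => [x0|x0]; last first.
  by congr Some; rewrite -[z]invrK -xy invf_div.
by move: xy; rewrite x0 mul0r => /esym/eqP; rewrite invr_eq0 (negbTE z0).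
Qed.

(** * Behaviour at zero and infinity *)

Lemma denom0C n k a : (0 < n) -> (polytoC (op_den n k a)).[0] = 1.
Proof.
case: n => // m _; rewrite -(rmorph0 (@toC R)) /polytoC /= horner_map /= denom0.
exact: rmorph1.
Qed.

Lemma opO_0 n k a : 0 < n -> opO n k a (Some 0) = Some 0.
Proof.
move=> n0; rewrite /opO rational_mapE /proj_point.
set p := polytoC (op_num n k a); set q := polytoC (op_den n k a).
set g := gcdp p q.
have q0 : q.[0] != 0 by rewrite /q denom0C // oner_neq0.
have pz : p.[0] = 0.
  case: n n0 @p @q @g q0 => // m m0 p q g _.
  rewrite -(rmorph0 (@toC R)) /p /polytoC /= horner_map /=.
  by rewrite hornerM hornerXn expr0n eqn0Ngt -ltz_nat m0 mul0r.
have qE : q = q %/ g * g by rewrite divpK // dvdp_gcdr.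
have pE : p = p %/ g * g by rewrite divpK // dvdp_gcdl.
move: q0 pz; rewrite {1}qE {1}pE !hornerM mulf_eq0 negb_or.
move=> /andP [q0 g0] /eqP.
by rewrite mulf_eq0 (negbTE g0) orbF => /eqP ->; rewrite (negbTE q0) mul0r.
Qed.

Lemma opO_oo n k a : 0 < n -> opO n k a None = None.
Proof.
move=> n0; rewrite /opO /rational_map.
set p := polytoC (op_num n k a); set q := polytoC (op_den n k a).
set g := gcdp p q.
have p0 : p != 0 by rewrite map_poly_eq0 op_num_neq0.
have g0 : g != 0 by rewrite gcdp_eq0 (negbTE p0).
have sqp : (size q < size p)%N.
  rewrite /p /q /polytoC !size_map_poly.
  case: n n0 @p @q @g p0 g0 => // m; rewrite ltz_nat => m0 _ _ _ _ _ /=.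
  rewrite mulrC size_mulXn ?numer_neq0 // sizeE_numer.
  rewrite (leq_ltn_trans (size_denom _ _)) // addnS ltnS.
  by rewrite -[k in (k < _)%N]add0n ltn_add2r.
have sqp' : (size (q %/ g)%R < size (p %/ g)%R)%N.
  rewrite !size_divp // ltn_sub2r //.
  rewrite (leq_trans _ (dvdp_leq p0 (dvdp_gcdl p q))) //.
  by rewrite prednK // size_poly_gt0.
rewrite (maxn_idPl (ltnW sqp')) [(q %/ g)`_ _]nth_default ?eqxx //.
by rewrite -ltnS prednK // (leq_ltn_trans _ sqp').
Qed.

(** * The factors of P *)

(** The Euler Wronskian of the unreduced fraction is X^|n| P, and it is a
    multiple of that of the reduced one. *)
Lemma root_critP n k a z
    (p := op_num n k a) (q := op_den n k a) (g := gcdp p q) :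
    z != 0 -> root (polytoC (eulerW (p %/ g) (q %/ g))) z ->
  root (polytoC (critP n k a)) z.
Proof.
move=> z0 Wz.
have : eulerW p q = 'X^(`|n|) * critP n k a by rewrite -critP_deriv.
have -> : p = g * (p %/ g) by rewrite mulrC divpK // dvdp_gcdl.
have -> : q = g * (q %/ g) by rewrite mulrC divpK // dvdp_gcdr.
rewrite eulerW_mull => /(congr1 (fun r => (polytoC r).[z])).
move/rootP: Wz; rewrite /polytoC !rmorphM !hornerM /= => ->.
rewrite mulr0 map_polyXn hornerXn.
by move/esym/eqP; rewrite mulf_eq0 expf_eq0 (negbTE z0) andbF.
Qed.

Lemma recip_palindromic m P : recip m P = P -> P`_m != 0 -> palindromic m P.
Proof.
move=> rP Pm; split.
  apply/eqP; rewrite eqn_leq -{1}rP size_recip ltnNge.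
  by apply: contra Pm => sP; rewrite nth_default.
by move=> i im; rewrite -{1}rP coef_recip im.
Qed.

Lemma dvdp_inverse_pair k P (r : R) : r != 0 -> recip (k + k) P = P ->
  root P r -> root P r^-1 -> ('X - r%:P) * ('X - (r^-1)%:P) %| P.
Proof.
move=> r0 rP Pr Pri; have [rr|rr] := eqVneq r r^-1; last first.
  by rewrite Gauss_dvdp ?dvdp_XsubCl ?Pr // coprimep_XsubC root_XsubC eq_sym.
rewrite -rr -expr2 (recip_fixed_double_root rP) //.
by rewrite expr2 {2}rr mulfV.
Qed.

(** With y = z + 1/z, the two inverse pairs give X^2 - y X + 1 and
    X^2 - conj(y) X + 1, whose product has the real coefficients
    1, - (y + conj y), 2 + y conj(y), - (y + conj y), 1. *)
Lemma inverse_conj_quartic z : z != 0 -> exists Q : {poly R}, palindromic 4 Q /\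
  polytoC Q = \prod_(w <- [:: z; z^-1; z^*; (z^*)^-1]) ('X - w%:P).
Proof.
move=> z0; have [y yz] : exists y, y = z + z^-1 by exists (z + z^-1).
have yE : y^* = z^* + (z^*)^-1 by rewrite yz rmorphD fmorphV.
have [c cE] : exists c, y + y^* = toC c.
  by apply: realC_toC; rewrite CrealE rmorphD /= conjCK addrC.
have [d dE] : exists d, 2 + y * y^* = toC d.
  by apply: realC_toC; rewrite CrealE rmorphD rmorphM /= conjCK rmorph_nat mulrC.
exists ('X^4 - c *: 'X^3 + d *: 'X^2 - c *: 'X^1 + 'X^0); split.
  apply: recip_palindromic.
    by rewrite !(linearD, linearN, linearZ) /= !recip_Xn //= !subSS !subn0; ring.
  by rewrite !coefE /= !mulr0 subr0 !addr0 oppr0 addr0 oner_neq0.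
have pairE (s : C) : s != 0 ->
    ('X - s%:P) * ('X - (s^-1)%:P) = 'X^2 - (s + s^-1)%:P * 'X + 1 :> {poly C}.
  move=> s0; rewrite polyCD.
  have <- : s%:P * (s^-1)%:P = 1 :> {poly C} by rewrite -polyCM mulfV.
  ring.
rewrite !big_cons big_nil mulr1 mulrA !pairE ?conjC_eq0 // -yE -yz.
rewrite /polytoC !(rmorphD, rmorphN) /= !map_polyZ !map_polyXn /= -cE -dE.
rewrite -!mul_polyC !(polyCD, polyCM) polyC1; ring.
Qed.

End RealCoefficients.

Lemma uniq_inverse_conj (K : numClosedFieldType) (z : K) :
  z \isn't Num.real -> `|z| != 1 -> uniq [:: z; z^-1; z^*; (z^*)^-1].
Proof.
move=> zNR z1.
have z0 : z != 0 by apply: contraNneq zNR => ->; rewrite real0.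
have zc : z != z^* by rewrite eq_sym -CrealE.
have zi : z != z^-1.
  apply: contraNneq zNR => zi.
  have /eqP : z ^+ 2 = 1 by rewrite expr2 {2}zi mulfV.
  by rewrite sqrf_eq1 => /orP [] /eqP ->; rewrite ?realN real1.
have zci : z != (z^*)^-1.
  apply: contraNneq z1 => zci; rewrite -(@pexpr_eq1 _ _ 2) // normCK.
  by rewrite {1}zci mulVf // conjC_eq0.
have zic : z^-1 != z^* by rewrite -(inj_eq invr_inj) invrK.
have cci : z^* != (z^*)^-1 by rewrite -fmorphV (inj_eq (can_inj (@conjCK K))).
by rewrite /= !inE !negb_or zc zi zci zic cci (inj_eq invr_inj) zc.
Qed.

Theorem proposition2p10 (R : realType) (n : int) (k : nat) (a : nat -> R)
    (hak : a k != 0) :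
  let O : sphere R -> sphere R := opO n k a in
  let P : {poly R} := critP n k a in
  let PC : {poly Cplx R} := polytoC P in
  let freeO (z : Cplx R) : Prop := free_critical_point O (Some z) in
  (0 < n -> ~ free_critical_point O (Some 0) /\ ~ free_critical_point O None)
  /\
  forall z : Cplx R, z != 0 -> freeO z ->
    [\/ (* a pair of inverse real roots *)
        exists r : R, [/\ z = toC r, freeO (toC r), freeO (toC r^-1)
          & ('X - r%:P) * ('X - (r^-1)%:P) %| P],
        (* a pair of complex conjugate roots on the unit circle *)
        [/\ z \isn't Num.real, `|z| = 1, freeO (z^*)
          & ('X - z%:P) * ('X - (z^*)%:P) %| PC]
      | (* the four roots of a real quartic palindromic factor of P *)
        [/\ uniq [:: z; z^-1; z^*; (z^*)^-1],
            [/\ freeO z, freeO z^-1, freeO z^* & freeO (z^*)^-1]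
          & exists Q : {poly R}, [/\ palindromic 4 Q, Q %| P
            & forall w : Cplx R,
                root (polytoC Q) w = (w \in [:: z; z^-1; z^*; (z^*)^-1])]]].
Proof.
move=> O P PC freeO; split.
  move=> n0; split=> [[_]|[_]]; first by rewrite /O opO_0.
  by rewrite /O opO_oo.
have [sp pq] := op_recip n k a.
have p0 : op_num n k a != 0 := op_num_neq0 n k a.
have free_inv w : w != 0 -> freeO w -> freeO w^-1.
  exact: free_critical_point_inv sp pq p0.
have free_conj w : w != 0 -> freeO w -> freeO w^*.
  exact: free_critical_point_conj p0.
have free_root w : w != 0 -> freeO w -> root PC w.
  by move=> w0 /(free_critical_pointP _ p0 w0) [Ww _]; apply: root_critP.
move=> z z0 zO; have zc0 : z^* != 0 by rewrite conjC_eq0.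
have [zR|zNR] := boolP (z \is Num.real).
  have [r zr] := realC_toC zR; apply: Or31; exists r.
  have r0 : r != 0 by move: z0; rewrite zr fmorph_eq0.
  have rO : freeO (toC r) by rewrite -zr.
  have riO : freeO (toC r^-1) by rewrite fmorphV /= -zr; exact: free_inv.
  split => //; apply: (dvdp_inverse_pair r0 (recip_critP n k a)).
    by rewrite -root_polytoC_toC free_root // -zr.
  by rewrite -root_polytoC_toC free_root // fmorph_eq0 invr_eq0.
have [z1|z1] := eqVneq `|z| 1.
  apply: Or32; split => //; first exact: free_conj.
  rewrite Gauss_dvdp ?dvdp_XsubCl ?free_root //; first exact: free_conj.
  by rewrite coprimep_XsubC root_XsubC -CrealE.
apply: Or33; have u4 := uniq_inverse_conj zNR z1.
have zcO := free_conj z z0 zO.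
have frees : [/\ freeO z, freeO z^-1, freeO z^* & freeO (z^*)^-1].
  by split => //; exact: free_inv.
split => //; have [Q [palQ QE]] := inverse_conj_quartic z0.
exists Q; split => // [|w]; last by rewrite QE root_prod_XsubC.
rewrite -(dvdp_map (@toC R)) -/(polytoC _) QE uniq_roots_dvdp ?uniq_rootsE //.
by case: frees => *; rewrite /= !free_root ?invr_eq0.
Qed.
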